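(* For each dimension $d$, let $V_o$ be the typical Poisson-Voronoi cell of a homogeneous Poisson point process with intensity $\lambda>0$ on $\mathbb{R}^d$, and let $\rho_d=1+\frac{\mathrm{Var}[\upsilon_d(V_o)]}{\mathbb{E}[\upsilon_d(V_o)]^2}$. Then $$\lim_{d\to\infty}\rho_d=1.$$
   Context: The typical cell of the Poisson-Voronoi tessellation generated by the Poisson point process $\Phi$ is $V_o=\{\mathbf{y}\in\mathbb{R}^d : \|\mathbf{y}\|\le\|\mathbf{x}-\mathbf{y}\|\ \ \forall\mathbf{x}\in\Phi\}$. $\upsilon_d$ is Lebesgue measure on $\mathbb{R}^d$. The intensity $\lambda$ is the same for all $d$. *)

(* Defs.v *)
From HB Require Import structures.
From mathcomp Require Import all_boot all_order all_algebra.
From mathcomp Require Import all_classical all_reals all_analysis.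
From mathcomp Require Import measurable_realfun.
Set Implicit Arguments.
Unset Strict Implicit.
Unset Printing Implicit Defensive.
Import Order.TTheory GRing.Theory Num.Theory.
Import numFieldNormedType.Exports.
Local Open Scope classical_set_scope.
Local Open Scope ring_scope.

(* R^d is d.-tuple R with its product sigma-algebra (= the Borel sets). *)

Section lebesgue_tuple.
Context {R : realType}.

Definition tuple_cons n (p : measurableTypeR R * n.-tuple R) : n.+1.-tuple R :=
  [tuple of p.1 :: p.2].

Lemma measurable_tuple_cons n : measurable_fun [set: _] (@tuple_cons n).
Proof. exact: (@measurable_cons _ _ _ R). Qed.

Section step.
Variables (n : nat) (mu : {sigma_finite_measure set (n.-tuple R) -> \bar R}).

Definition lebesgue_cons : set (n.+1.-tuple R) -> \bar R :=
  pushforward (lebesgue_measure \x mu)%E (@tuple_cons n).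

Let lebesgue_cons0 : lebesgue_cons set0 = 0%E.
Proof. by rewrite /lebesgue_cons /pushforward preimage_set0 measure0. Qed.

Let lebesgue_cons_ge0 A : (0 <= lebesgue_cons A)%E.
Proof. by rewrite /lebesgue_cons /pushforward measure_ge0. Qed.

Let lebesgue_cons_sigma_additive : semi_sigma_additive lebesgue_cons.
Proof.
move=> F mF tF mUF; rewrite /lebesgue_cons /pushforward preimage_bigcup.
apply: measure_semi_sigma_additive.
- by move=> k; rewrite -[X in measurable X]setTI; exact: measurable_tuple_cons.
- apply/trivIsetP => /= i j _ _ ij; rewrite -preimage_setI.
  by move/trivIsetP : tF => /(_ _ _ _ _ ij) ->//; rewrite preimage_set0.
- rewrite -preimage_bigcup -[X in measurable X]setTI.
  exact: measurable_tuple_cons.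
Qed.

HB.instance Definition _ := isMeasure.Build _ _ _ lebesgue_cons
  lebesgue_cons0 lebesgue_cons_ge0 lebesgue_cons_sigma_additive.

Let lebesgue_cons_sigma_finite : sigma_finite setT lebesgue_cons.
Proof.
have /sigma_finiteP[F [TF ndF Foo]] := sigma_finiteT (@lebesgue_measure R).
have /sigma_finiteP[G [TG ndG Goo]] := sigma_finiteT mu.
have [split splitK msplit] :
    exists2 split : n.+1.-tuple R -> measurableTypeR R * n.-tuple R,
      cancel (@tuple_cons n) split & measurable_fun [set: n.+1.-tuple R] split.
  exists (fun t => (thead t, [tuple of behead t])).
    by case=> x t; congr pair; apply: val_inj.
  apply/measurable_fun_pairP; split.
    exact: (@measurable_tnth _ R n.+1 ord0).
  exact: (@measurable_behead _ R n).
exists (fun k => split @^-1` (F k `*` G k)).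
  apply/seteqP; split => // t _.
  have [m _ Fx] : (\bigcup_i F i) (split t).1 by rewrite -TF.
  have [k _ Gu] : (\bigcup_i G i) (split t).2 by rewrite -TG.
  exists (maxn m k) => //; split => /=.
    by have /subsetPset := ndF _ _ (leq_maxl m k); apply.
  by have /subsetPset := ndG _ _ (leq_maxr m k); apply.
move=> k; have [mF Foo_k] := Foo k; have [mG Goo_k] := Goo k; split.
  by rewrite -[X in measurable X]setTI; apply: msplit => //; exact: measurableX.
rewrite /lebesgue_cons /pushforward.
have -> : @tuple_cons n @^-1` (split @^-1` (F k `*` G k)) = F k `*` G k.
  by apply/seteqP; split => p /=; rewrite splitK.
by rewrite product_measure1E// lte_mul_pinfty// ge0_fin_numE.
Qed.

HB.instance Definition _ := Measure_isSigmaFinite.Build _ _ _ lebesgue_cons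
  lebesgue_cons_sigma_finite.

End step.

Fixpoint lebesgue_tuple d : {sigma_finite_measure set (d.-tuple R) -> \bar R} :=
  if d is n.+1 then lebesgue_cons (lebesgue_tuple n) else \d_[tuple].

Lemma lebesgue_tuple_box d (A : 'I_d -> set (measurableTypeR R)) :
  (forall i, measurable (A i)) ->
  lebesgue_tuple d [set t | forall i, A i (tnth t i)] =
  (\prod_(i < d) lebesgue_measure (A i))%E.
Proof.
elim: d A => [|d IH] A mA.
  rewrite big_ord0 /= diracE mem_set//.
  by move=> [].
rewrite big_ord_recl -IH//= /lebesgue_cons /pushforward.
set B := [set t : d.-tuple R | _].
have mB : measurable B.
  rewrite (_ : B = \big[setI/setT]_(i < d) ((@tnth d R)^~ i @^-1` A (lift ord0 i))).
    apply: bigsetI_measurable => i _; rewrite -[X in measurable X]setTI.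
    by apply: measurable_tnth => //; exact: mA.
  rewrite -bigcap_seq; apply/seteqP; split => [t Bt i _|t Bt i]; first exact: Bt.
  exact/Bt/mem_index_enum.
rewrite -product_measure1E//; congr product_measure1.
apply/seteqP; split => -[x t] /=.
  move=> At; split; first exact: (At ord0).
  by move=> i; have := At (lift ord0 i); rewrite tnthS.
move=> [Ax Bt] i; case: (unliftP ord0 i) => [j ->|->]//.
by rewrite tnthS; exact: Bt.
Qed.

End lebesgue_tuple.

Section point_process.
Context {R : realType} {d : nat}.

(* The norm the library puts on vectors is the sup norm. *)
Definition euclidean_norm (x : d.-tuple R) : R :=
  Num.sqrt (\sum_(i < d) tnth x i ^+ 2).

Definition tuple_sub (x y : d.-tuple R) : d.-tuple R :=
  [tuple tnth x i - tnth y i | i < d].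

Definition locally_finite (A : set (d.-tuple R)) : Prop :=
  forall r : R, finite_set (A `&` [set y | euclidean_norm y <= r]).

Definition typical_cell (A : set (d.-tuple R)) : set (d.-tuple R) :=
  [set y | forall x, A x -> euclidean_norm y <= euclidean_norm (tuple_sub x y)].

Context {disp : measure_display} {Omega : measurableType disp}.
Variables (P : probability Omega R) (Phi : Omega -> set (d.-tuple R)).

Definition number_of_points (B : set (d.-tuple R)) (w : Omega) : \bar R :=
  counting (Phi w `&` B).

(* The product rule for subfamilies is the case E i = setT for the other i. *)
Definition mutually_independent n (X : 'I_n -> Omega -> \bar R) : Prop :=
  forall E : 'I_n -> set (\bar R), (forall i, measurable (E i)) ->
  P [set w | forall i, E i (X i w)] =
  (\prod_(i < n) P [set w | E i (X i w)])%E.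

(* A simple point process, seen as a random locally finite set.  The second
   argument of poisson_prob is a dummy: poisson_prob r k does not depend on k,
   and for r = 0 it is the Dirac mass at 0. *)
Record homogeneous_poisson_process (lambda : R) : Prop := {
  poisson_locally_finite : forall w, locally_finite (Phi w) ;
  poisson_measurable : forall B, measurable B ->
    measurable_fun [set: Omega] (number_of_points B) ;
  poisson_count : forall B, measurable B -> (lebesgue_tuple d B < +oo)%E ->
    forall k : nat, P [set w | number_of_points B w = k%:R%:E] =
      poisson_prob (lambda * fine (lebesgue_tuple d B)) 0%N [set k] ;
  poisson_independent : forall n (B : 'I_n -> set (d.-tuple R)),
    (forall i, measurable (B i)) -> trivIset [set: 'I_n] B ->
    mutually_independent (fun i => number_of_points (B i)) }.

(* fine only acts on the null event that the cell has infinite volume. *)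
Definition cell_volume (w : Omega) : R :=
  fine (lebesgue_tuple d (typical_cell (Phi w))).

Definition rho : \bar R :=
  (1 + 'V_P[cell_volume] / 'E_P[cell_volume] ^+ 2)%E.

End point_process.

(* Main.v *)
Require Import Defs.
From mathcomp Require Import all_boot all_order all_algebra.
From mathcomp Require Import all_classical all_reals all_analysis.
From mathcomp Require Import measurable_realfun.
From mathcomp Require Import ring lra.
Import Order.TTheory GRing.Theory Num.Theory.
Import numFieldNormedType.Exports.
Local Open Scope classical_set_scope.
Local Open Scope ring_scope.

Set Implicit Arguments.
Unset Strict Implicit.
Unset Printing Implicit Defensive.

(** Write B_y for the open ball about y whose boundary passes through the
    origin (cell_ball).  The point y lies in the typical cell exactly when the
    process has no point in B_y (typical_cell_void), an event of probability
    exp(- lambda |B_y|).  By Tonelli the cell volume V satisfies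

      E[V]   = int_y exp(- lambda |B_y|) dy,
      E[V^2] = int_y int_z exp(- lambda |B_y `|` B_z|) dz dy

    (expectation_cell_volume, second_moment_cell_volume).  If the two balls were
    disjoint the second integrand would be a product and V would have no
    variance, so Var[V] measures their overlap, and the theorem says that in
    high dimension two such balls hardly overlap.

    For a fixed cut-off T, pairs for which lambda |B_y| or lambda |B_z| reaches
    T contribute at most a multiple of exp(- T / 4), uniformly in d.  For the
    other pairs exp(- lambda |B_y `|` B_z|) exceeds the product by at most
    lambda |B_y `&` B_z| (expR_union_le), so it remains to average
    |B_y `&` B_z| over the z with |z| < r, where r is the radius at which the
    cut-off is reached.  By Tonelli this average is the integral over x in B_y
    of the volume of the z in the r-ball with x in B_z.  Such a z satisfies
    |z - x / 2|^2 < r^2 - |x|^2 / 4 (midpoint_cap).  Hence, unless x lies in the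
    ball of radius r / 2, z is confined to a ball of radius r sqrt (15 / 16);
    both exceptional balls have a volume exponentially smaller in d than that of
    the r-ball (cell_ball_overlap).

    The volumes of all balls are compared through the sublevel sets of
    y |-> lambda |B_y|: the one at height s has volume s / lambda in every
    dimension (lebesgue_cell_rate_sublevel), which makes the estimates uniform
    in d.  Altogether (rho_le), for every T >= 0 and d > 0,

      1 <= rho <= 1 + e^2 (T^3 overlap_decay d + 256 exp(- T / 4)),

    and the limit follows by choosing first T and then d. *)

(** * Euclidean geometry of tuples *)

Section euclidean_geometry.
Context {R : realType} {d : nat}.
Implicit Types (x y z : d.-tuple R) (a r : R).

Definition tuple_affine a x y : d.-tuple R :=
  [tuple a * tnth y i + tnth x i | i < d].

Lemma tnth_sub x y i : tnth (tuple_sub x y) i = tnth x i - tnth y i.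
Proof. by rewrite tnth_mktuple. Qed.

Lemma euclidean_norm_ge0 x : 0 <= euclidean_norm x.
Proof. exact: sqrtr_ge0. Qed.

Lemma sqr_euclidean_norm x : euclidean_norm x ^+ 2 = \sum_(i < d) tnth x i ^+ 2.
Proof. by rewrite sqr_sqrtr// sumr_ge0// => i _; exact: sqr_ge0. Qed.

Lemma ltr_euclidean_norm x y : (euclidean_norm x < euclidean_norm y) =
  (euclidean_norm x ^+ 2 < euclidean_norm y ^+ 2).
Proof. by rewrite ltr_sqr// nnegrE euclidean_norm_ge0. Qed.

(** The sharp side is r / sqrt d; with d.+1 the inequality is strict and there
    is no division by 0. *)
Lemma euclidean_norm_lt_cube x r : 0 < r ->
  (forall i, `|tnth x i| <= r / d.+1%:R) -> euclidean_norm x < r.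
Proof.
move=> r0 xr; rewrite -ltr_sqr ?nnegrE ?euclidean_norm_ge0 ?(ltW r0)//.
rewrite sqr_euclidean_norm.
apply: (@le_lt_trans _ _ (\sum_(i < d) (r / d.+1%:R) ^+ 2)).
  apply: ler_sum => i _; rewrite -(real_normK (num_real (tnth x i))).
  by rewrite ler_sqr ?nnegrE ?divr_ge0// ltW.
rewrite sumr_const card_ord expr_div_n -[X in X < _]mulr_natr mulrAC.
rewrite ltr_pdivrMr ?exprn_gt0//.
rewrite ltr_pM2l ?exprn_gt0// -natrX ltr_nat.
by rewrite expnS (leq_trans (ltnSn d))// leq_pmulr.
Qed.

Lemma euclidean_norm_coord x i : `|tnth x i| <= euclidean_norm x.
Proof.
rewrite -ler_sqr ?nnegrE ?euclidean_norm_ge0// sqr_euclidean_norm.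
rewrite (bigD1 i)//= real_normK ?num_real// lerDl.
by apply: sumr_ge0 => j _; exact: sqr_ge0.
Qed.

(** Cauchy-Schwarz, by expanding the sum of the squares of b x_i - a y_i. *)
Lemma dot_le_euclidean_norm x y :
  \sum_(i < d) tnth x i * tnth y i <= euclidean_norm x * euclidean_norm y.
Proof.
set a := euclidean_norm x; set b := euclidean_norm y.
have [ab0|ab0] := leP (a * b) 0.
  have {ab0} : (a == 0) || (b == 0).
    by rewrite -mulf_eq0 eq_le ab0 mulr_ge0// euclidean_norm_ge0.
  by move=> /orP[] /eqP c0; rewrite big1 ?mulr_ge0 ?euclidean_norm_ge0// => i _;
    [have := euclidean_norm_coord x i|have := euclidean_norm_coord y i];
    rewrite -/a -/b c0 normr_le0 => /eqP ->; rewrite (mul0r, mulr0).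
have : 0 <= \sum_(i < d) (b * tnth x i - a * tnth y i) ^+ 2.
  by apply: sumr_ge0 => i _; exact: sqr_ge0.
have -> : \sum_(i < d) (b * tnth x i - a * tnth y i) ^+ 2 =
    b ^+ 2 * (\sum_(i < d) tnth x i ^+ 2) +
    a ^+ 2 * (\sum_(i < d) tnth y i ^+ 2) -
    (2 * (a * b)) * \sum_(i < d) tnth x i * tnth y i.
  rewrite !mulr_sumr -big_split/= -sumrB; apply: eq_bigr => i _; ring.
rewrite -!sqr_euclidean_norm -/a -/b subr_ge0.
have -> : b ^+ 2 * a ^+ 2 + a ^+ 2 * b ^+ 2 = (2 * (a * b)) * (a * b) by ring.
by rewrite ler_pM2l// mulr_gt0.
Qed.

Lemma euclidean_distance_triangle x y z :
  euclidean_norm (tuple_sub x z) <=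
  euclidean_norm (tuple_sub x y) + euclidean_norm (tuple_sub y z).
Proof.
rewrite -ler_sqr ?nnegrE ?addr_ge0 ?euclidean_norm_ge0//.
rewrite sqrrD 3!sqr_euclidean_norm.
under eq_bigr do rewrite tnth_sub.
have -> : \sum_(i < d) (tnth x i - tnth z i) ^+ 2 =
    \sum_(i < d) tnth (tuple_sub x y) i ^+ 2 +
    (\sum_(i < d) tnth (tuple_sub x y) i * tnth (tuple_sub y z) i) *+ 2 +
    \sum_(i < d) tnth (tuple_sub y z) i ^+ 2.
  rewrite -sumrMnl -!big_split/=; apply: eq_bigr => i _.
  rewrite !tnth_sub; ring.
by rewrite lerD2r lerD2l lerMn2r/= dot_le_euclidean_norm.
Qed.

Lemma euclidean_norm_sub_sym x y :
  euclidean_norm (tuple_sub x y) = euclidean_norm (tuple_sub y x).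
Proof.
by congr Num.sqrt; apply: eq_bigr => i _; rewrite !tnth_sub -sqrrN opprB.
Qed.

Lemma euclidean_norm_sub_affine a x y z : 0 <= a ->
  euclidean_norm (tuple_sub (tuple_affine a x y) (tuple_affine a x z)) =
  a * euclidean_norm (tuple_sub y z).
Proof.
move=> a0; rewrite /euclidean_norm -[in RHS](ger0_norm a0).
rewrite -sqrtr_sqr -sqrtrM ?sqr_ge0//.
congr Num.sqrt; rewrite mulr_sumr; apply: eq_bigr => i _.
rewrite !tnth_sub !tnth_mktuple; ring.
Qed.

Definition euclidean_ball x r : set (d.-tuple R) :=
  [set y | euclidean_norm (tuple_sub y x) < r].

Definition tuple_origin : d.-tuple R := [tuple 0 | i < d].

Lemma tuple_sub_origin x : tuple_sub x tuple_origin = x.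
Proof. by apply: eq_from_tnth => i; rewrite tnth_sub tnth_mktuple subr0. Qed.

Lemma tuple_affine_origin a x : tuple_affine a x tuple_origin = x.
Proof.
by apply: eq_from_tnth => i; rewrite !tnth_mktuple mulr0 add0r.
Qed.

(** By the parallelogram law |y - x / 2|^2 is the mean of |y|^2 and |x - y|^2
    minus |x|^2 / 4.  This confines the centres y of the balls that pass through
    the origin and contain x. *)
Lemma midpoint_cap x y r :
  euclidean_norm y < r -> euclidean_norm (tuple_sub x y) < euclidean_norm y ->
  euclidean_norm (tuple_sub y (tuple_affine (2^-1) tuple_origin x)) ^+ 2 <
    r ^+ 2 - euclidean_norm x ^+ 2 / 4.
Proof.
move=> yr; have r0 : 0 <= r by apply: le_trans (euclidean_norm_ge0 y) (ltW yr).
have : euclidean_norm y ^+ 2 < r ^+ 2.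
  by rewrite ltr_sqr ?nnegrE ?euclidean_norm_ge0.
rewrite ltr_euclidean_norm => {}yr xy.
have -> : euclidean_norm (tuple_sub y (tuple_affine (2^-1) tuple_origin x)) ^+ 2
    = euclidean_norm y ^+ 2 / 2 + euclidean_norm (tuple_sub x y) ^+ 2 / 2 -
      euclidean_norm x ^+ 2 / 4.
  rewrite !sqr_euclidean_norm !mulr_suml -big_split/= -sumrB.
  by apply: eq_bigr => i _; rewrite !tnth_sub !tnth_mktuple; field.
by lra.
Qed.

End euclidean_geometry.

(** * Volumes of Euclidean balls *)

Section lebesgue_affine_line.
Context {R : realType}.
Variables (a c : R) (a_gt0 : 0 < a).
Local Notation mu := (@lebesgue_measure R).

Let aff (x : measurableTypeR R) : measurableTypeR R := a * x + c.

Let maff : measurable_fun setT aff.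
Proof. by apply: measurable_funD => //; exact: measurable_funM. Qed.

(** Uniqueness of Lebesgue measure reduces this to half-open intervals. *)
Lemma lebesgue_measure_preimage_affine (A : set (measurableTypeR R)) :
  measurable A ->
  mu A = (a%:E * mu ((fun x => (a * x + c)%R) @^-1` A))%E.
Proof.
move=> mA.
pose nu := mscale (NngNum (ltW a_gt0)) (pushforward mu aff).
rewrite (@lebesgue_measure_unique _ (nu maff))//.
move=> _ [[u v] _ <-]; rewrite /= /nu/= /mscale/= /pushforward.
have -> : aff @^-1` `]u, v] = [set` `](u - c) / a, (v - c) / a]].
  apply/seteqP; split => x /=;
    rewrite /aff !in_itv/= ltr_pdivrMr// ler_pdivlMr//;
  by rewrite ltrBlDr lerBrDr mulrC.
rewrite !lebesgue_measure_itv/= !lte_fin ltr_pM2r ?invr_gt0// ltrD2r.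
case: ifP => _; last by rewrite mule0.
rewrite -!EFinB -EFinM; congr EFin; field.
by rewrite gt_eqF.
Qed.

Lemma ge0_integral_lebesgue_affine (f : R -> \bar R) :
  measurable_fun setT f -> (forall x, 0 <= f x)%E ->
  (\int[mu]_x f x = a%:E * \int[mu]_x f (a * x + c)%R)%E.
Proof.
move=> mf f0.
pose nu := mscale (NngNum (ltW a_gt0)) (pushforward mu aff).
rewrite (eq_measure_integral (nu maff)); last first.
  by move=> A mA _; rewrite [LHS]lebesgue_measure_preimage_affine.
by rewrite ge0_integral_mscale//= ge0_integral_pushforward.
Qed.

End lebesgue_affine_line.

Lemma measurable_tuple_affine (R : realType) d (a : R) (c : d.-tuple R) :
  measurable_fun [set: d.-tuple R] (tuple_affine a c).
Proof.
apply/measurable_fun_tnthP => i.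
rewrite (_ : _ \o _ = fun t => a * tnth t i + tnth c i).
  by apply: measurable_funD => //; apply: measurable_funM => //;
    exact: measurable_tnth.
by apply/funext => t /=; rewrite tnth_mktuple.
Qed.

(** Induction on d along the definition of the measure: the section of the
    preimage over x is the preimage of the section over a * x + thead c, and the
    change of variable on the first axis supplies the remaining factor a. *)
Lemma lebesgue_tuple_preimage_affine (R : realType) d (a : R) (c : d.-tuple R)
    (A : set (d.-tuple R)) : 0 < a -> measurable A ->
  lebesgue_tuple d A =
    ((a ^+ d)%:E * lebesgue_tuple d (tuple_affine a c @^-1` A))%E.
Proof.
move=> a0; elim: d => [|d IH] in c A *.
  move=> mA; rewrite expr0 mul1e; congr (lebesgue_tuple _ _).
  have affE t : tuple_affine a c t = t by apply: eq_from_tnth => -[].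
  by apply/seteqP; split => t /=; rewrite affE.
move=> mA /=; rewrite /lebesgue_cons /pushforward.
set B := @tuple_cons R d @^-1` A.
have mB : measurable B by rewrite -[B]setTI; exact: measurable_tuple_cons.
rewrite /product_measure1/=.
rewrite (ge0_integral_lebesgue_affine (thead c) a0)//; last first.
  exact: measurable_fun_xsection.
rewrite exprS EFinM -muleA; congr (_ * _)%E.
set C := @tuple_cons R d @^-1` _.
have mC : measurable C.
  rewrite -[C]setTI; apply: measurable_tuple_cons => //.
  by rewrite -[X in measurable X]setTI; exact: measurable_tuple_affine.
rewrite -ge0_integralZl//; last 2 first.
- exact: measurable_fun_xsection.
- by rewrite lee_fin exprn_ge0// ltW.
apply: eq_integral => x _ /=; rewrite (IH [tuple of behead c])//; last first.
  exact: measurable_xsection.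
congr (_ * lebesgue_tuple d _)%E.
have affE t :
    tuple_cons (a * x + thead c, tuple_affine a [tuple of behead c] t) =
    tuple_affine a c (tuple_cons (x, t)).
  case/tupleP: c {IH C mC B mB mA A} => c0 c; apply: eq_from_tnth => i.
  case: (unliftP ord0 i) => [j ->|->]; last by rewrite tnth_mktuple !tnth0.
  rewrite tnth_mktuple !tnthS tnth_mktuple; congr (_ + tnth _ _).
  exact: val_inj.
by apply/seteqP; split => t /=; rewrite /xsection/= !inE /B /C /= affE.
Qed.

Lemma measurable_ltr_set (R : realType) disp (T : measurableType disp)
    (f g : T -> R) :
  measurable_fun setT f -> measurable_fun setT g ->
  measurable [set t | f t < g t].
Proof.
move=> mf mg; rewrite (_ : mkset _ = ~` (setT `&` [set t | g t <= f t])).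
  by apply: measurableC; exact: measurable_fun_le.
by rewrite setTI; apply/seteqP; split => t /=; rewrite ltNge => /negP.
Qed.

Section ball_volume.
Context {R : realType} {d : nat}.
Implicit Types (x y z : d.-tuple R) (a r : R).
Local Notation mu := (@lebesgue_tuple R d).

Lemma measurable_euclidean_distance disp (T : measurableType disp)
    (f g : T -> d.-tuple R) :
  measurable_fun setT f -> measurable_fun setT g ->
  measurable_fun setT (fun t => euclidean_norm (tuple_sub (f t) (g t))).
Proof.
move=> mf mg; apply: (@measurableT_comp _ _ _ _ _ _ (fun u : R => Num.sqrt u) _
  (fun t => \sum_(i < d) tnth (tuple_sub (f t) (g t)) i ^+ 2)).
  exact: continuous_measurable_fun (@sqrt_continuous R).
apply: measurable_sum => i; apply: measurable_funX.
under eq_fun do rewrite tnth_sub.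
by apply: measurable_funB; apply: (measurableT_comp (measurable_tnth i)).
Qed.

Lemma measurable_euclidean_norm : measurable_fun setT (@euclidean_norm R d).
Proof.
rewrite (_ : euclidean_norm =
  fun x => euclidean_norm (tuple_sub x (tuple_origin : d.-tuple R))).
  exact: measurable_euclidean_distance.
by apply/funext => x; rewrite tuple_sub_origin.
Qed.

Lemma measurable_euclidean_ball x r : measurable (euclidean_ball x r).
Proof.
by apply: measurable_ltr_set => //; exact: measurable_euclidean_distance.
Qed.

Definition unit_ball_volume : R := fine (mu (euclidean_ball tuple_origin 1)).

Lemma measurable_cube (D : set (measurableTypeR R)) : measurable D ->
  measurable [set t : d.-tuple R | forall i, D (tnth t i)].
Proof.
move=> mD; rewrite (_ : mkset _ =
  \bigcap_(i in [set: 'I_d]) ((@tnth d R)^~ i @^-1` D)).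
  apply: fin_bigcap_measurable => // i _; rewrite -[X in measurable X]setTI.
  exact: measurable_tnth.
by apply/seteqP; split => [t Dt i _|t Dt i]; exact: Dt.
Qed.

Lemma lebesgue_tuple_cube a : 0 < a ->
  mu [set t | forall i, [set` `[- a, a]%R] (tnth t i)] = ((2 * a) ^+ d)%:E.
Proof.
move=> a0; rewrite (lebesgue_tuple_box (A := fun=> [set` `[- a, a]%R]));
  last first.
  by move=> i; exact: measurable_itv.
rewrite lebesgue_measure_itv/= lte_fin ifT; last by lra.
by rewrite -EFinB opprK prodEFin prodr_const card_ord mulr_natl mulr2n.
Qed.

Lemma unit_ball_lty : (mu (euclidean_ball tuple_origin 1) < +oo)%E.
Proof.
apply: le_lt_trans (ltry ((2 * 1) ^+ d)); rewrite -lebesgue_tuple_cube//.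
apply: le_measure; rewrite ?inE.
- exact: measurable_euclidean_ball.
- by apply: measurable_cube; exact: measurable_itv.
- move=> t; rewrite /euclidean_ball /= tuple_sub_origin => t1 i /=.
  by rewrite in_itv/= -ler_norml (le_trans (euclidean_norm_coord _ _))// ltW.
Qed.

Lemma unit_ball_volume_gt0 : 0 < unit_ball_volume.
Proof.
rewrite fine_gt0// unit_ball_lty andbT.
have d1 : 0 < 1 / d.+1%:R :> R by rewrite divr_gt0.
apply: (@lt_le_trans _ _ ((2 * (1 / d.+1%:R)) ^+ d)%:E).
  by rewrite lte_fin exprn_gt0// mulr_gt0.
rewrite -lebesgue_tuple_cube//; apply: le_measure; rewrite ?inE.
- by apply: measurable_cube; exact: measurable_itv.
- exact: measurable_euclidean_ball.
- move=> t /= td; rewrite /euclidean_ball/= tuple_sub_origin.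
  apply: euclidean_norm_lt_cube => // i.
  by have := td i; rewrite in_itv/= -ler_norml.
Qed.

(** The affine map that sends the unit ball onto the given one scales volumes by
    r ^+ d; this is where translation invariance and homogeneity enter. *)
Lemma lebesgue_euclidean_ball x r : (0 < d)%N -> 0 <= r ->
  mu (euclidean_ball x r) = (unit_ball_volume * r ^+ d)%:E.
Proof.
move=> d0; rewrite le_eqVlt => /predU1P[<-|r0].
  rewrite expr0n (gtn_eqF d0) mulr0 -[RHS](measure0 mu); congr (mu _).
  apply/seteqP; split => // y; rewrite /euclidean_ball/= ltNge.
  by rewrite euclidean_norm_ge0.
rewrite (lebesgue_tuple_preimage_affine x r0);
  last exact: measurable_euclidean_ball.
rewrite mulrC EFinM; congr (_ * _)%E.
rewrite fineK ?ge0_fin_numE ?unit_ball_lty//; congr (mu _).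
apply/seteqP; split => y; rewrite /euclidean_ball/=;
  rewrite -[X in tuple_sub (tuple_affine _ _ _) X](tuple_affine_origin r x);
  by rewrite euclidean_norm_sub_affine ?(ltW r0)// gtr_pMr.
Qed.

(** The origin lies on the boundary of this ball: a point of the process inside
    it is closer to y than the origin is. *)
Definition cell_ball y := euclidean_ball y (euclidean_norm y).

Lemma measurable_cell_ball y : measurable (cell_ball y).
Proof. exact: measurable_euclidean_ball. Qed.

Lemma measurable_cell_ball_graph disp (T : measurableType disp)
    (f g : T -> d.-tuple R) :
  measurable_fun setT f -> measurable_fun setT g ->
  measurable [set t | cell_ball (f t) (g t)].
Proof.
move=> mf mg; apply: measurable_ltr_set;
  first exact: measurable_euclidean_distance.
exact: (measurableT_comp measurable_euclidean_norm).
Qed.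

Lemma lebesgue_cell_ball y : (0 < d)%N ->
  mu (cell_ball y) = (unit_ball_volume * euclidean_norm y ^+ d)%:E.
Proof. by move=> d0; rewrite lebesgue_euclidean_ball// euclidean_norm_ge0. Qed.

End ball_volume.

(** * Overlap of two balls through the origin *)

(** The volume fractions, in a ball, of the concentric ball of half its radius
    and of the ball that contains a cap. *)
Definition overlap_decay {R : realType} (d : nat) : R :=
  2^-1 ^+ d + Num.sqrt (15 / 16) ^+ d.

Section overlap.
Context {R : realType} {d : nat}.
Hypothesis d_gt0 : (0 < d)%N.
Implicit Types (x y z : d.-tuple R) (a r : R).
Local Notation mu := (@lebesgue_tuple R d).
Local Notation kappa := (@unit_ball_volume R d).
Local Notation o := (@tuple_origin R d : d.-tuple R).

(** The cap lies in the ball of midpoint_cap, and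
    r^2 - |x|^2 / 4 <= r^2 - r^2 / 16. *)
Lemma lebesgue_cap_le x r : 0 <= r -> r / 2 <= euclidean_norm x ->
  (mu [set z | (euclidean_norm z < r)%R /\ cell_ball z x] <=
    (kappa * (Num.sqrt (15 / 16) * r) ^+ d)%:E)%E.
Proof.
move=> r0 rx; set s := Num.sqrt _ * r.
have s0 : 0 <= s by rewrite mulr_ge0.
rewrite -(lebesgue_euclidean_ball (tuple_affine 2^-1 o x))//.
apply: le_measure; rewrite ?inE.
- apply: measurableI; last exact: measurable_cell_ball_graph.
  by apply: measurable_ltr_set => //; exact: measurable_euclidean_norm.
- exact: measurable_euclidean_ball.
move=> z [zr xz]; rewrite /euclidean_ball/=.
rewrite -ltr_sqr ?nnegrE ?euclidean_norm_ge0//.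
apply: lt_le_trans (midpoint_cap zr xz) _.
rewrite exprMn [Num.sqrt (15 / 16) ^+ 2]sqr_sqrtr; last by lra.
have : (r / 2) ^+ 2 <= euclidean_norm x ^+ 2.
  by rewrite ler_sqr ?nnegrE ?euclidean_norm_ge0// divr_ge0.
rewrite expr_div_n; lra.
Qed.

(** Exchanging the integrals over z and over the points x of the intersection
    leaves the caps of lebesgue_cap_le.  The trivial bound on the cap is used
    when x is within r / 2 of the origin;
      other x range over cell_ball y, whose volume
    is at most that of the ball of radius r. *)
Lemma cell_ball_overlap y r : euclidean_norm y < r ->
  (\int[mu]_(z in euclidean_ball o r) mu (cell_ball y `&` cell_ball z) <=
    ((kappa * r ^+ d) ^+ 2 * overlap_decay d)%:E)%E.
Proof.
move=> yr; have r0 : 0 <= r by apply: le_trans (euclidean_norm_ge0 y) (ltW yr).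
pose S : set (d.-tuple R * d.-tuple R) := [set p |
  euclidean_norm p.1 < r /\ (cell_ball y p.2 /\ cell_ball p.1 p.2)].
have mS : measurable S.
  apply: measurableI; last first.
    by apply: measurableI; exact: measurable_cell_ball_graph.
  apply: measurable_ltr_set => //.
  exact: (measurableT_comp measurable_euclidean_norm).
have kr0 : 0 <= kappa * r ^+ d.
  by rewrite mulr_ge0 ?exprn_ge0// ltW// unit_ball_volume_gt0.
pose c : R := Num.sqrt (15 / 16).
have kc0 : 0 <= kappa * (c * r) ^+ d.
  by rewrite mulr_ge0 ?exprn_ge0 ?mulr_ge0 ?sqrtr_ge0// ltW//
    unit_ball_volume_gt0.
have kr0' : (0 <= (kappa * r ^+ d)%:E)%E by rewrite lee_fin.
have kc0' : (0 <= (kappa * (c * r) ^+ d)%:E)%E by rewrite lee_fin.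
rewrite [leLHS](_ : _ = \int[mu]_z (mu \o xsection S) z)%E; last first.
  rewrite integral_mkcond; apply: eq_integral => z _ /=; rewrite patchE.
  have -> : xsection S z =
      if z \in euclidean_ball o r then cell_ball y `&` cell_ball z else set0.
    apply/seteqP; split => x; rewrite /xsection/= inE.
      move=> [zr yzx]; rewrite mem_set//.
      by rewrite /euclidean_ball/= tuple_sub_origin.
    case: ifPn => // /set_mem; rewrite /euclidean_ball/= tuple_sub_origin.
    by move=> zr [yx zx]; split.
  by case: ifPn; rewrite ?measure0.
have -> : (\int[mu]_z (mu \o xsection S) z = \int[mu]_x (mu \o ysection S) x)%E.
  have := indic_fubini_tonelli mu mu mS.
  by rewrite indic_fubini_tonelli_FE// indic_fubini_tonelli_GE.
have measurable_ind x s :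
    measurable_fun setT (fun z => (\1_(euclidean_ball x s) z : R)%:E).
  by apply/measurable_EFinP; apply: measurable_indic;
    exact: measurable_euclidean_ball.
pose h x : \bar R :=
  ((kappa * r ^+ d)%:E * (\1_(euclidean_ball o (r / 2)) x)%:E +
  (kappa * (c * r) ^+ d)%:E * (\1_(cell_ball y) x)%:E)%E.
apply: (@le_trans _ _ (\int[mu]_x h x)%E).
  apply: ge0_le_integral => //.
  - exact: measurable_fun_ysection.
  - by apply: emeasurable_funD; apply: measurable_funeM; exact: measurable_ind.
  move=> x _ /=; rewrite /h !indicE.
  have [yx|yx] := pselect (cell_ball y x); last first.
    rewrite (_ : ysection S x = set0) ?measure0.
      by rewrite adde_ge0// mule_ge0.
    by apply/seteqP; split => // z; rewrite /ysection/= inE => -[_ []].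
  rewrite (_ : ysection S x = [set z | euclidean_norm z < r /\ cell_ball z x]);
    last first.
    by apply/seteqP; split => z; rewrite /ysection/= inE;
      [move=> [? []]|move=> []; split].
  rewrite (mem_set yx) mule1.
  have [rx|rx] := leP (r / 2) (euclidean_norm x).
    by apply: le_trans (lebesgue_cap_le r0 rx) _; rewrite leeDr// mule_ge0.
  rewrite (mem_set (_ : euclidean_ball o (r / 2) x)); last first.
    by rewrite /euclidean_ball/= tuple_sub_origin.
  rewrite mule1 -[leLHS]adde0 leeD// -(lebesgue_euclidean_ball o)//.
  apply: le_measure; rewrite ?inE.
  - apply: measurableI; last exact: measurable_cell_ball_graph.
    by apply: measurable_ltr_set => //; exact: measurable_euclidean_norm.
  - exact: measurable_euclidean_ball.
  by move=> z [zr _]; rewrite /euclidean_ball/= tuple_sub_origin.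
rewrite ge0_integralD//; last 4 first.
- by move=> x _; rewrite mule_ge0.
- by apply: measurable_funeM; exact: measurable_ind.
- by move=> x _; rewrite mule_ge0.
- by apply: measurable_funeM; exact: measurable_ind.
rewrite ge0_integralZl//.
rewrite ge0_integralZl//; last exact: measurable_ind.
rewrite !integral_indic//; last 2 first.
- exact: measurable_cell_ball.
- exact: measurable_euclidean_ball.
rewrite !setIT.
rewrite [X in (_ * X + _)%E](lebesgue_euclidean_ball _ d_gt0) ?divr_ge0//.
rewrite [X in (_ + _ * X)%E](lebesgue_cell_ball _ d_gt0).
rewrite -!EFinM -EFinD lee_fin /overlap_decay -/c mulrDr; apply: lerD.
  by rewrite !exprMn; lra.
rewrite exprMn.
have : euclidean_norm y ^+ d <= r ^+ d.
  by rewrite lerXn2r ?nnegrE ?euclidean_norm_ge0// ltW.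
have : 0 <= kappa * (kappa * r ^+ d) * c ^+ d.
  by rewrite !mulr_ge0 ?exprn_ge0 ?sqrtr_ge0// ltW// unit_ball_volume_gt0.
nra.
Qed.

End overlap.

(** * Integrals over the space of centres *)

Lemma expr_root_exists (R : realType) (d : nat) (a : R) : (0 < d)%N -> 0 <= a ->
  exists2 r : R, 0 <= r & r ^+ d = a.
Proof.
move=> d0 a0; exists (a `^ d%:R^-1); first exact: powR_ge0.
by rewrite -powR_mulrn ?powR_ge0// -powRrM mulVf ?powRr1// pnatr_eq0 gtn_eqF.
Qed.

(** Here a and b are the expected numbers of points in two sets, u and v those
    in their union and intersection.  If a and b are below T, then
    exp(- u) - exp(- a - b) = exp(- u) (1 - exp(- v)) <= v.  Otherwise T <= u,
    and u is at least (T + a + b) / 4. *)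
Lemma expR_union_le (R : realType) (a b u v T : R) : 0 <= u -> 0 <= v ->
  u = a + b - v -> a <= u -> b <= u ->
  expR (- u) <= expR (- a) * expR (- b) +
    (if (a < T) && (b < T) then v else 0) +
    expR (- (T / 4)) * (expR (- (a / 4)) * expR (- (b / 4))).
Proof.
move=> u0 v0 uE au bu; case: ifPn => [_|ab].
  rewrite -expRD -[leLHS]addr0; apply: lerD;
    last by rewrite !mulr_ge0 ?expR_ge0.
  have -> : - a + - b = - u + - v by lra.
  rewrite expRD.
  have u1 : expR (- u) <= 1 by rewrite -expR0 ler_expR; lra.
  have uge0 : 0 <= expR (- u) by exact: expR_ge0.
  have := expR_ge1Dx (- v).
  nra.
rewrite addr0 -!expRD -[leLHS]add0r; apply: lerD; first exact: expR_ge0.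
rewrite ler_expR; move: ab; rewrite negb_and -!leNgt => /orP[] ?; lra.
Qed.

Section cell_rate.
Context {R : realType} {d : nat}.
Variable lambda : R.
Hypothesis lambda_gt0 : 0 < lambda.
Hypothesis d_gt0 : (0 < d)%N.
Implicit Types (x y z : d.-tuple R) (a r s : R).
Local Notation mu := (@lebesgue_tuple R d).
Local Notation kappa := (@unit_ball_volume R d).
Local Notation o := (@tuple_origin R d : d.-tuple R).

(** The expected number of points in cell_ball y, see cell_rateE. *)
Definition cell_rate y := lambda * (kappa * euclidean_norm y ^+ d).

Let kappa_gt0 : 0 < kappa. Proof. exact: unit_ball_volume_gt0. Qed.

Lemma cell_rate_ge0 y : 0 <= cell_rate y.
Proof. by rewrite !mulr_ge0 ?exprn_ge0 ?euclidean_norm_ge0// ltW. Qed.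

Lemma cell_rateE y : cell_rate y = lambda * fine (mu (cell_ball y)).
Proof. by rewrite lebesgue_cell_ball. Qed.

Lemma measurable_cell_rate : measurable_fun setT cell_rate.
Proof.
apply: measurable_funM => //; apply: measurable_funM => //.
apply: measurable_funX; exact: measurable_euclidean_norm.
Qed.

Lemma measurable_expR_cell_rate a :
  measurable_fun setT (fun y => (expR (- (cell_rate y / a)))%:E).
Proof.
apply/measurable_EFinP; apply: (measurableT_comp (@measurable_expR R)).
by apply: measurableT_comp => //; apply: measurable_funM => //;
  exact: measurable_cell_rate.
Qed.

Let measurable_expR_rate :
  measurable_fun setT (fun y => (expR (- cell_rate y))%:E).
Proof.
by have := measurable_expR_cell_rate 1; under eq_fun do rewrite divr1.
Qed.

Let measurable_expR_rate4 :
  measurable_fun setT (fun y => (expR (- (cell_rate y / 4)))%:E).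
Proof. exact: measurable_expR_cell_rate. Qed.

Lemma cell_rate_sublevel s : 0 <= s -> exists r, [/\ 0 <= r,
  [set y | cell_rate y < s] = euclidean_ball o r &
  lambda * (kappa * r ^+ d) = s].
Proof.
move=> s0; have lk0 : 0 < lambda * kappa by rewrite mulr_gt0.
have [|r r0 rE] := @expr_root_exists R d (s / (lambda * kappa)) d_gt0.
  by rewrite divr_ge0// ltW.
have sE : lambda * (kappa * r ^+ d) = s by rewrite mulrA rE mulrC divfK ?gt_eqF.
exists r; split => //; apply/seteqP; split => y;
  by rewrite /euclidean_ball/= tuple_sub_origin -sE /cell_rate !ltr_pM2l//
     ltr_pXn2r ?nnegrE ?euclidean_norm_ge0.
Qed.

Lemma measurable_cell_rate_sublevel s : measurable [set y | cell_rate y < s].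
Proof. by apply: measurable_ltr_set => //; exact: measurable_cell_rate. Qed.

(** The image of Lebesgue measure under cell_rate is lambda^-1 times Lebesgue
    measure on the half-line, whatever the dimension.  This makes the bounds
    below uniform in d. *)
Lemma lebesgue_cell_rate_sublevel s : 0 <= s ->
  mu [set y | cell_rate y < s] = (s / lambda)%:E.
Proof.
move=> /cell_rate_sublevel[r [r0 -> <-]].
by rewrite lebesgue_euclidean_ball// [X in _ = X%:E]mulrC mulKf// gt_eqF.
Qed.

(** The exact value is 4 / lambda.  A cruder constant comes from covering the
    space by the sublevel sets of height 8 (n + 1): on the n-th layer the
    integrand is at most exp(- 2 n) <= 4^-n, and 4^-n (n + 1) is summable. *)
Lemma integral_expR_cell_rate_le :
  (\int[mu]_y (expR (- (cell_rate y / 4)))%:E <= (16 / lambda)%:E)%E.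
Proof.
pose f n y : \bar R := ((4 ^+ n)^-1%:E *
  (\1_[set y | cell_rate y < 8 * n.+1%:R] y)%:E)%E.
have f0 n y : (0 <= f n y)%E by rewrite mule_ge0 ?lee_fin ?invr_ge0 ?exprn_ge0.
have mf n : measurable_fun setT (f n).
  by apply: measurable_funeM; apply/measurable_EFinP; apply: measurable_indic;
    exact: measurable_cell_rate_sublevel.
apply: (@le_trans _ _ (\int[mu]_y \sum_(0 <= n <oo) f n y)%E).
  apply: ge0_le_integral => //.
    by apply: (ge0_emeasurable_sum (P := xpredT)).
  move=> y _.
  pose n := Num.truncn (cell_rate y / 8).
  have rate8 : 0 <= cell_rate y / 8 by rewrite divr_ge0// cell_rate_ge0.
  have /andP[n1 n2] := truncn_itv rate8.
  apply: (@le_trans _ _ (f n y)); last first.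
    by rewrite (nneseriesD1 (n := n))// leeDl// nneseries_ge0.
  rewrite /f indicE mem_set/= ?mule1; last first.
    by move: n2; rewrite -/n; lra.
  rewrite lee_fin -/n in n1 *.
  apply: (@le_trans _ _ (expR (- (n%:R * 2)))).
    by rewrite ler_expR; lra.
  rewrite expRN lef_pV2 ?posrE ?exprn_gt0 ?expR_gt0//.
  rewrite expRM_natl lerXn2r ?nnegrE ?expR_ge0//.
  have e1 := @expR_ge1Dx R 1.
  rewrite (_ : 2 = 2%:R * 1); last by rewrite mulr1.
  by rewrite expRM_natl; nra.
rewrite integral_nneseries//.
apply: le_trans (@epsilon_trick0 R (16 / lambda) xpredT _); last first.
  by rewrite divr_ge0// ltW.
apply: lee_nneseries => [n _|n _].
  by rewrite integral_ge0// => y _; exact: f0.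
rewrite /f ge0_integralZl//; last first.
  apply/measurable_EFinP; apply: measurable_indic;
    exact: measurable_cell_rate_sublevel.
rewrite integral_indic// ?setIT; last exact: measurable_cell_rate_sublevel.
rewrite [X in (_ * X)%E]lebesgue_cell_rate_sublevel ?mulr_ge0//.
rewrite -EFinM lee_fin.
have n2 : n.+1%:R <= 2 ^+ n :> R by rewrite -natrX ler_nat ltn_expl.
have p0 : 0 < 2 ^+ n :> R by rewrite exprn_gt0.
have -> : 4 ^+ n = 2 ^+ n * 2 ^+ n :> R by rewrite -exprMn; congr (_ ^+ _); lra.
rewrite natrX exprS.
have -> : 16 / lambda / (2 * 2 ^+ n) =
    (2 ^+ n * 2 ^+ n)^-1 * (8 * 2 ^+ n / lambda) :> R.
  by field; rewrite !gt_eqF.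
by rewrite ler_wpM2l ?invr_ge0 ?mulr_ge0 ?(ltW p0)// ler_pM2r ?invr_gt0//
  ler_pM2l.
Qed.

(** The sublevel set of height 1 alone contributes this much. *)
Lemma integral_expR_cell_rate_ge :
  ((expR (- 1) / lambda)%:E <= \int[mu]_y (expR (- cell_rate y))%:E)%E.
Proof.
pose S := [set y | cell_rate y < 1].
have mS : measurable S := measurable_cell_rate_sublevel 1.
have -> : ((expR (- 1) / lambda)%:E =
    \int[mu]_(y in S) (expR (- 1))%:E)%E.
  by rewrite integral_cst// [X in (_ * X)%E]lebesgue_cell_rate_sublevel// mul1r.
apply: (@le_trans _ _ (\int[mu]_(y in S) (expR (- cell_rate y))%:E)%E).
  apply: ge0_le_integral => //; first exact: measurable_funTS.
  by move=> y /= y1; rewrite lee_fin ler_expR lerN2 ltW.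
exact: ge0_subset_integral.
Qed.

Lemma integral_expR_cell_rate_lty :
  (\int[mu]_y (expR (- cell_rate y))%:E < +oo)%E.
Proof.
apply: le_lt_trans (ltry (16 / lambda));
  apply: le_trans integral_expR_cell_rate_le.
apply: ge0_le_integral => // y _.
by rewrite lee_fin ler_expR; have := cell_rate_ge0 y; lra.
Qed.

Definition union_rate y z := lambda * fine (mu (cell_ball y `|` cell_ball z)).
Definition overlap_rate y z := lambda * fine (mu (cell_ball y `&` cell_ball z)).

Let union_rate_ge0 y z : 0 <= union_rate y z.
Proof. by rewrite mulr_ge0 ?fine_ge0// ltW. Qed.

Let overlap_rate_ge0 y z : 0 <= overlap_rate y z.
Proof. by rewrite mulr_ge0 ?fine_ge0// ltW. Qed.

Let cell_ball_lty y : (mu (cell_ball y) < +oo)%E.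
Proof. by rewrite lebesgue_cell_ball// ltry. Qed.

Lemma lebesgue_cell_ballU_lty y z : (mu (cell_ball y `|` cell_ball z) < +oo)%E.
Proof.
apply: le_lt_trans
  (measureU2 mu (measurable_cell_ball y) (measurable_cell_ball z)) _.
exact: lte_add_pinfty (cell_ball_lty y) (cell_ball_lty z).
Qed.

Let overlap_lty y z : (mu (cell_ball y `&` cell_ball z) < +oo)%E.
Proof.
apply: le_lt_trans (cell_ball_lty y); apply: le_measure; rewrite ?inE.
- exact: measurableI (measurable_cell_ball y) (measurable_cell_ball z).
- exact: measurable_cell_ball.
- exact: subIsetl.
Qed.

Let measurable_union_rate : measurable_fun setT (fun p => union_rate p.1 p.2).
Proof.
pose S : set ((d.-tuple R * d.-tuple R) * d.-tuple R) :=
  [set q | (cell_ball q.1.1 `|` cell_ball q.1.2) q.2].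
have mS : measurable S.
  by apply: measurableU; apply: measurable_cell_ball_graph => //;
    exact: measurableT_comp.
apply: measurable_funM => //.
rewrite (_ : (fun p => _) = fine \o (mu \o xsection S)).
  by apply: measurableT_comp;
    [exact: fine_measurable|exact: measurable_fun_xsection].
apply/funext => -[y z] /=; congr (fine (mu _)).
by apply/seteqP; split => x; rewrite /xsection/= inE.
Qed.

Let measurable_overlap :
  measurable_fun setT (fun p => mu (cell_ball p.1 `&` cell_ball p.2)).
Proof.
pose S : set ((d.-tuple R * d.-tuple R) * d.-tuple R) :=
  [set q | (cell_ball q.1.1 `&` cell_ball q.1.2) q.2].
have mS : measurable S.
  by apply: measurableI; apply: measurable_cell_ball_graph => //;
    exact: measurableT_comp.
rewrite (_ : (fun p => _) = mu \o xsection S);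
  first exact: measurable_fun_xsection.
apply/funext => -[y z] /=; congr (mu _).
by apply/seteqP; split => x; rewrite /xsection/= inE.
Qed.

Let union_rateE y z :
  union_rate y z = cell_rate y + cell_rate z - overlap_rate y z.
Proof.
rewrite /union_rate (measureUfinl (measurable_cell_ball y)
  (measurable_cell_ball z) (cell_ball_lty y)).
rewrite !cell_rateE -mulrDr -mulrBr -fineD ?ge0_fin_numE ?cell_ball_lty//.
by rewrite -fineB ?fin_numD ?ge0_fin_numE ?cell_ball_lty ?overlap_lty.
Qed.

Let cell_rate_le_union y z :
  cell_rate y <= union_rate y z /\ cell_rate z <= union_rate y z.
Proof.
rewrite !cell_rateE !ler_pM2l//
  !fine_le ?ge0_fin_numE ?lebesgue_cell_ballU_lty//;
  apply: le_measure; rewrite ?inE; try exact: measurable_cell_ball;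
  try exact: measurableU (measurable_cell_ball y) (measurable_cell_ball z).
- exact: subsetUr.
- exact: subsetUl.
Qed.

(** This is cell_ball_overlap for the radius at which the rate equals T, with
    the ball volume written as T / lambda. *)
Lemma integral_overlap_le y T : cell_rate y < T ->
  (\int[mu]_(z in [set z | (cell_rate z < T)%R]) (overlap_rate y z)%:E <=
    (T ^+ 2 / lambda * overlap_decay d)%:E)%E.
Proof.
move=> yT; have T0 : 0 <= T by rewrite (le_trans (cell_rate_ge0 y))// ltW.
have [r [r0 rT lE]] := cell_rate_sublevel T0.
have yr : euclidean_norm y < r.
  have : [set y | cell_rate y < T] y by [].
  by rewrite rT /euclidean_ball/= tuple_sub_origin.
rewrite rT /overlap_rate.
under eq_integral do rewrite EFinM fineK ?ge0_fin_numE//.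
rewrite ge0_integralZl//; last 3 first.
- exact: measurable_euclidean_ball.
- apply: measurable_funTS.
  exact: measurableT_comp measurable_overlap (pair1_measurable y).
- by rewrite lee_fin ltW.
apply: le_trans (lee_wpmul2l _ (cell_ball_overlap d_gt0 yr)) _.
  by rewrite lee_fin ltW.
rewrite -EFinM lee_fin mulrA ler_wpM2r//.
  by rewrite addr_ge0 ?exprn_ge0 ?sqrtr_ge0.
rewrite -lE le_eqVlt; apply/orP; left; apply/eqP; field.
by rewrite gt_eqF.
Qed.

Local Notation M := (\int[mu]_y (expR (- cell_rate y))%:E)%E.
Local Notation C := (\int[mu]_y (expR (- (cell_rate y / 4)))%:E)%E.

Local Notation K T := (T ^+ 2 / lambda * overlap_decay d).

Definition truncated_overlap T y z : R :=
  if (cell_rate y < T) && (cell_rate z < T) then overlap_rate y z else 0.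

Let measurable_truncated_overlap T y :
  measurable_fun setT (fun z => (truncated_overlap T y z)%:E).
Proof.
apply/measurable_EFinP; apply: measurable_fun_ifT => //.
  apply: measurable_and => //; apply: measurable_fun_ltr => //.
  exact: measurable_cell_rate.
apply: measurable_funM => //; apply: measurableT_comp;
  first exact: fine_measurable.
exact: measurableT_comp measurable_overlap (pair1_measurable y).
Qed.

Let truncated_overlap_ge0 T y z : (0 <= (truncated_overlap T y z)%:E)%E.
Proof. by rewrite lee_fin /truncated_overlap; case: ifP. Qed.

Let measurable_union_integrand :
  measurable_fun setT (fun p => (expR (- union_rate p.1 p.2))%:E).
Proof.
apply/measurable_EFinP; apply: (measurableT_comp (@measurable_expR R)).
by apply: measurableT_comp => //; exact: measurable_union_rate.
Qed.

Let integral_truncated_overlap_le T y : 0 <= T ->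
  (\int[mu]_z (truncated_overlap T y z)%:E <=
    (K T)%:E * (\1_[set y | (cell_rate y < T)%R] y)%:E)%E.
Proof.
move=> T0; rewrite indicE; have [yT|yT] := boolP (cell_rate y < T).
  rewrite mem_set//= mule1; apply: le_trans (integral_overlap_le yT).
  rewrite [leRHS]integral_mkcond le_eqVlt; apply/orP; left; apply/eqP.
  apply: eq_integral => z _; rewrite patchE /truncated_overlap yT/=.
  have [zT|zT] := boolP (cell_rate z < T); first by rewrite mem_set.
  by rewrite memNset//; exact/negP.
rewrite memNset//=; last exact/negP.
by rewrite mule0 integral0_eq// => z _; rewrite /truncated_overlap (negbTE yT).
Qed.

(** expR_union_le integrated over z. *)
Let integral_union_section_le T y : 0 <= T ->
  (\int[mu]_z (expR (- union_rate y z))%:E <=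
   (expR (- cell_rate y))%:E * M +
   (K T)%:E * (\1_[set y | (cell_rate y < T)%R] y)%:E +
   (expR (- (T / 4)))%:E * C * (expR (- (cell_rate y / 4)))%:E)%E.
Proof.
move=> T0.
pose e1 z := ((expR (- cell_rate y))%:E * (expR (- cell_rate z))%:E)%E.
pose e2 z := ((expR (- (T / 4)) * expR (- (cell_rate y / 4)))%:E *
  (expR (- (cell_rate z / 4)))%:E)%E.
have me1 : measurable_fun setT e1 by exact: measurable_funeM.
have me2 : measurable_fun setT e2 by exact: measurable_funeM.
have e1_ge0 z : (0 <= e1 z)%E by rewrite /e1 -EFinM lee_fin mulr_ge0 ?expR_ge0.
have e2_ge0 z : (0 <= e2 z)%E by rewrite /e2 -EFinM lee_fin !mulr_ge0 ?expR_ge0.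
have me1c :
    measurable_fun setT (fun z => e1 z + (truncated_overlap T y z)%:E)%E.
  exact: emeasurable_funD.
apply: (@le_trans _ _
    (\int[mu]_z (e1 z + (truncated_overlap T y z)%:E + e2 z))%E).
  apply: ge0_le_integral => //.
  - exact: measurableT_comp measurable_union_integrand (pair1_measurable y).
  - exact: emeasurable_funD.
  - move=> z _; have [yu zu] := cell_rate_le_union y z.
    rewrite /e1 /e2 -!EFinM -!EFinD lee_fin -mulrA.
    exact: expR_union_le (union_rate_ge0 y z) (overlap_rate_ge0 y z)
      (union_rateE y z) yu zu.
rewrite ge0_integralD//; last by move=> z _; exact: adde_ge0.
rewrite ge0_integralD// ge0_integralZl// ge0_integralZl//.
apply: leeD; first by apply: leeD => //; exact: integral_truncated_overlap_le.
by rewrite EFinM -muleA [X in (_ * X)%E]muleC muleA.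
Qed.

(** The three terms of expR_union_le, integrated over z and then over y: the
    product gives M * M, the overlap is integrated over a set of volume
    T / lambda, and the tail is bounded by integral_expR_cell_rate_le. *)
Lemma integral_union_le T : 0 <= T ->
  (\int[mu]_y \int[mu]_z (expR (- union_rate y z))%:E <=
   M * M + (T ^+ 3 * overlap_decay d / lambda ^+ 2)%:E +
   (expR (- (T / 4)) * (16 / lambda) ^+ 2)%:E)%E.
Proof.
move=> T0.
have C0 : (0 <= C)%E by apply: integral_ge0 => y _; rewrite lee_fin expR_ge0.
have M0 : (0 <= M)%E by apply: integral_ge0 => y _; rewrite lee_fin expR_ge0.
have K0 : 0 <= K T.
  by rewrite !mulr_ge0 ?invr_ge0 ?exprn_ge0 ?(ltW lambda_gt0)//
    addr_ge0 ?exprn_ge0 ?sqrtr_ge0.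
pose e1 y := ((expR (- cell_rate y))%:E * M)%E.
pose e2 y := ((K T)%:E * (\1_[set y | (cell_rate y < T)%R] y)%:E)%E.
pose e3 y := ((expR (- (T / 4)))%:E * C * (expR (- (cell_rate y / 4)))%:E)%E.
have me1 : measurable_fun setT e1.
  by apply: emeasurable_funM.
have measurable_ind : measurable_fun setT
    (fun y => (\1_[set y | cell_rate y < T] y : R)%:E).
  by apply/measurable_EFinP; apply: measurable_indic;
    exact: measurable_cell_rate_sublevel.
have me2 : measurable_fun setT e2 by exact: measurable_funeM.
have me3 : measurable_fun setT e3 by exact: measurable_funeM.
have e1_ge0 y : (0 <= e1 y)%E by rewrite mule_ge0// lee_fin expR_ge0.
have e2_ge0 y : (0 <= e2 y)%E by rewrite mule_ge0.
have e3_ge0 y : (0 <= e3 y)%E by rewrite !mule_ge0 ?lee_fin ?expR_ge0.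
apply: (@le_trans _ _ (\int[mu]_y (e1 y + e2 y + e3 y))%E).
  apply: ge0_le_integral => //.
  - by move=> y _; apply: integral_ge0 => z _; rewrite lee_fin expR_ge0.
  - have u0 p : (0 <= (expR (- union_rate p.1 p.2))%:E)%E.
      by rewrite lee_fin expR_ge0.
    exact: (measurable_fun_fubini_tonelli_F (m2 := lebesgue_tuple d) _
      measurable_union_integrand u0).
  - by apply: emeasurable_funD => //; exact: emeasurable_funD.
  - by move=> y _; exact: integral_union_section_le.
rewrite ge0_integralD//; last 2 first.
- by move=> y _; exact: adde_ge0.
- exact: emeasurable_funD.
rewrite ge0_integralD//; apply: leeD; first apply: leeD.
- by rewrite /e1 ge0_integralZr.
- rewrite /e2 ge0_integralZl// integral_indic//; last first.
    exact: measurable_cell_rate_sublevel.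
  rewrite setIT [X in (_ * X)%E]lebesgue_cell_rate_sublevel// -EFinM lee_fin.
  rewrite le_eqVlt; apply/orP; left; apply/eqP; field.
  by rewrite gt_eqF.
- rewrite /e3 ge0_integralZl//; last by rewrite mule_ge0// lee_fin expR_ge0.
  rewrite -muleA EFinM lee_wpmul2l ?lee_fin ?expR_ge0// expr2 EFinM.
  by rewrite lee_pmul// integral_expR_cell_rate_le.
Qed.

End cell_rate.

(** * Void probabilities and measurability of the typical cell *)

Lemma counting_eq0 (T : choiceType) (R : realType) (A : set T) :
  counting A = 0%:E :> \bar R <-> A = set0.
Proof.
rewrite /counting; split => [|->].
  case: asboolP => // fA [/eqP]; rewrite pnatr_eq0 => /eqP cA0.
  exact/(fset_set_set0 fA)/finmap.cardfs0_eq.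
by rewrite fset_set0; case: asboolP => // -[]; exact: finite_set0.
Qed.

Lemma poisson_prob_set0 (R : realType) (r : R) (k : nat) : 0 <= r ->
  poisson_prob r k [set 0%N] = (expR (- r))%:E.
Proof.
rewrite /poisson_prob le_eqVlt => /predU1P[<-|r0].
  by rewrite ltxx diracE mem_set//= oppr0 expR0.
rewrite r0 esum_set1 /poisson_pmf r0.
  by rewrite expr0 fact0 invr1 !mul1r.
by rewrite expr0 fact0 invr1 !mul1r lee_fin expR_ge0.
Qed.

(** Density of the rational points; the rational ball centres make the union in
    measurable_cell_graph countable. *)
Lemma euclidean_ball_rational (R : realType) d (x : d.-tuple R) (e : R) :
  0 < e ->
  exists q : d.-tuple rat, euclidean_ball (map_tuple ratr q) e x.
Proof.
move=> e0; have ed : 0 < e / d.+1%:R by rewrite divr_gt0.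
have /choice[q qP] : forall i : 'I_d, exists p : rat,
    `|tnth x i - ratr p| <= e / d.+1%:R.
  move=> i; have [|p] := @rat_in_itvoo R
    (tnth x i - e / d.+1%:R) (tnth x i + e / d.+1%:R).
    by rewrite ltrD2l gtrN.
  by rewrite in_itv/= -ltr_distlC => /ltW; exists p.
exists [tuple q i | i < d]; apply: euclidean_norm_lt_cube => // i.
by rewrite tnth_sub tnth_map tnth_mktuple.
Qed.

Section poisson_cell.
Context {R : realType} {d : nat} {disp : measure_display}.
Context {Omega : measurableType disp} (P : probability Omega R).
Context (Phi : Omega -> set (d.-tuple R)) (lambda : R).
Hypothesis lambda_gt0 : 0 < lambda.
Hypothesis PhiP : homogeneous_poisson_process P Phi lambda.
Local Notation mu := (@lebesgue_tuple R d).

Definition void_event (B : set (d.-tuple R)) : set Omega :=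
  [set w | Phi w `&` B = set0].

Lemma measurable_void_event (B : set (d.-tuple R)) :
  measurable B -> measurable (void_event B).
Proof.
move=> mB; rewrite (_ : void_event B = number_of_points Phi B @^-1` [set 0%:E]).
  by rewrite -[X in measurable X]setTI; apply: (poisson_measurable PhiP).
by apply/seteqP; split => w /=; rewrite /number_of_points counting_eq0.
Qed.

Lemma void_probability (B : set (d.-tuple R)) :
  measurable B -> (mu B < +oo)%E ->
  P (void_event B) = (expR (- (lambda * fine (mu B))))%:E.
Proof.
move=> mB muB; rewrite -(poisson_prob_set0 0%N); last first.
  by rewrite mulr_ge0 ?(ltW lambda_gt0)// fine_ge0.
rewrite -(poisson_count PhiP)//; congr (P _); apply/seteqP; split => w /=;
  by rewrite /number_of_points counting_eq0.
Qed.

Lemma typical_cell_void w y :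
  typical_cell (Phi w) y <-> void_event (cell_ball y) w.
Proof.
split => [cy|vy x Px].
  apply/seteqP; split => // x [/cy]; rewrite /cell_ball /euclidean_ball/=.
  by rewrite leNgt => /negP.
rewrite leNgt; apply/negP => xy.
by have : (Phi w `&` cell_ball y) x by []; rewrite vy.
Qed.

Definition cell_graph : set (Omega * d.-tuple R) :=
  [set p | typical_cell (Phi p.1) p.2].

(** A point y is outside the cell iff some rational ball that contains a point
    of the process fits into cell_ball y.  The condition of fitting is replaced
    by the inequality that implies it by the triangle inequality, because the
    inequality is visibly measurable in y.  So the complement of the graph is a
    countable union of measurable rectangles. *)
Lemma measurable_cell_graph : measurable cell_graph.
Proof.
pose q_ (i : d.-tuple rat * rat) : d.-tuple R := map_tuple ratr i.1.
pose s_ (i : d.-tuple rat * rat) : R := ratr i.2.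
pose F i := (~` void_event (euclidean_ball (q_ i) (s_ i))) `*`
  [set y | euclidean_norm (tuple_sub (q_ i) y) + s_ i <= euclidean_norm y].
rewrite -[cell_graph]setCK; apply: measurableC.
rewrite (_ : ~` cell_graph = \bigcup_i F i).
  apply: countable_bigcupT_measurable => // i; apply: measurableX.
    by apply: measurableC; apply: measurable_void_event;
      exact: measurable_euclidean_ball.
  rewrite -[X in measurable X]setTI; apply: measurable_fun_le => //.
    by apply: measurable_funD => //; exact: measurable_euclidean_distance.
  exact: measurable_euclidean_norm.
apply/seteqP; split => -[w y] /=; rewrite /cell_graph/=.
  move=> /existsNP[x /not_implyP[Px /negP]]; rewrite -ltNge => xy.
  (* A quarter of the gap g for the distance to the rational centre leaves room
     for a rational radius between g / 4 and g / 2. *)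
  set g := euclidean_norm y - euclidean_norm (tuple_sub x y).
  have g0 : 0 < g by rewrite subr_gt0.
  have [|q qx] := @euclidean_ball_rational R d x (g / 4);
    first by rewrite divr_gt0.
  have [|s] := @rat_in_itvoo R (g / 4) (g / 2); first by lra.
  rewrite in_itv/= => /andP[s1 s2].
  exists (q, s) => //; split => /=.
    move=> /seteqP[/(_ x) + _]; apply; split => //.
    by rewrite /euclidean_ball/= /s_/= (lt_trans _ s1).
  have := euclidean_distance_triangle (q_ (q, s)) x y.
  rewrite (euclidean_norm_sub_sym _ x).
  move: qx; rewrite /euclidean_ball/= /q_/= /s_/=.
  rewrite /g in s1 s2 *; lra.
move=> [[q s] _ [/= /eqP/set0P[x [Px]]]]; rewrite /euclidean_ball/= => xq qy.
apply/existsNP; exists x; apply/not_implyP; split => //; apply/negP;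
  rewrite -ltNge.
have := euclidean_distance_triangle x (q_ (q, s)) y; lra.
Qed.

End poisson_cell.

(** * Moments of the cell volume *)

Lemma Lfun2_of_sqr_lty d (T : measurableType d) (R : realType)
    (P : probability T R) (X : T -> R) : measurable_fun setT X ->
  (\int[P]_w (X w ^+ 2)%:E < +oo)%E -> X \in Lfun P 2%:E.
Proof.
move=> mX X2; rewrite inE; apply/andP; split; rewrite inE//=.
rewrite /finite_norm unlock poweR_lty//.
under eq_integral => w _ do rewrite /= powR_mulrn// real_normK ?num_real//.
exact: X2.
Qed.

Section moments.
Context {R : realType} {d : nat} {disp : measure_display}.
Context {Omega : measurableType disp} (P : probability Omega R).
Context (Phi : Omega -> set (d.-tuple R)) (lambda : R).
Hypothesis lambda_gt0 : 0 < lambda.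
Hypothesis d_gt0 : (0 < d)%N.
Hypothesis PhiP : homogeneous_poisson_process P Phi lambda.
Local Notation mu := (@lebesgue_tuple R d).

Let volume w := mu (typical_cell (Phi w)).
Let measurable_graph : measurable (cell_graph Phi) :=
  measurable_cell_graph PhiP.

Let xsection_cell_graph w : xsection (cell_graph Phi) w = typical_cell (Phi w).
Proof. by apply/seteqP; split => y; rewrite /xsection/= inE. Qed.

Let measurable_cell w : measurable (typical_cell (Phi w)).
Proof. by rewrite -xsection_cell_graph; exact: measurable_xsection. Qed.

Let volumeE : volume = mu \o xsection (cell_graph Phi).
Proof. by apply/funext => w; rewrite /= xsection_cell_graph. Qed.

Let measurable_volume : measurable_fun setT volume.
Proof. by rewrite volumeE; exact: measurable_fun_xsection. Qed.

Let volume_ge0 w : (0 <= volume w)%E.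
Proof. by rewrite /volume. Qed.

Lemma mean_cell_volume :
  (\int[P]_w mu (typical_cell (Phi w)) =
   \int[mu]_y (expR (- cell_rate lambda y))%:E)%E.
Proof.
rewrite -/volume [LHS](_ : _ =
    \int[P]_w (mu \o xsection (cell_graph Phi)) w)%E; last first.
  by rewrite -volumeE.
have := indic_fubini_tonelli P mu measurable_graph.
rewrite indic_fubini_tonelli_FE// indic_fubini_tonelli_GE// => ->.
apply: eq_integral => y _ /=.
rewrite (_ : ysection _ y = void_event Phi (cell_ball y)); last first.
  by apply/seteqP; split => w; rewrite /ysection/= inE => /typical_cell_void.
rewrite (void_probability lambda_gt0 PhiP) ?cell_rateE//.
- exact: measurable_cell_ball.
- by rewrite lebesgue_cell_ball// ltry.
Qed.

(** The square of the volume is the volume of the pairs (y, z) in the cell.  The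
    points y and z are moved out of the expectation one after the other; what is
    left inside is the event that the union of their two balls is void. *)
Lemma second_moment_cell_volume :
  (\int[P]_w (mu (typical_cell (Phi w)) * mu (typical_cell (Phi w))) =
   \int[mu]_y \int[mu]_z (expR (- union_rate lambda y z))%:E)%E.
Proof.
pose H : set ((Omega * d.-tuple R) * d.-tuple R) :=
  [set q | cell_graph Phi q.1 /\ cell_graph Phi (q.1.1, q.2)].
have mH : measurable H.
  apply: measurableI; rewrite -[X in measurable X]setTI.
    exact: (measurable_fst measurableT _ measurable_graph).
  have mq : measurable_fun setT
      (fun q : (Omega * d.-tuple R) * d.-tuple R => (q.1.1, q.2)).
    by apply: measurable_fun_pair => //;
      exact: measurableT_comp measurable_fst measurable_fst.
  exact: (mq measurableT _ measurable_graph).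
pose f p : \bar R := mu (xsection H p).
have mf : measurable_fun setT f by exact: measurable_fun_xsection.
have f0 p : (0 <= f p)%E by exact: measure_ge0.
have fE w y : f (w, y) = (volume w * (\1_(typical_cell (Phi w)) y)%:E)%E.
  rewrite /f indicE; have [yw|yw] := pselect (typical_cell (Phi w) y).
    rewrite mem_set// mule1; congr (mu _).
    by apply/seteqP; split => z; rewrite /xsection/= inE; [case|split].
  rewrite memNset// mule0 -[RHS](measure0 mu); congr (mu _).
  by apply/seteqP; split => // z; rewrite /xsection/= inE => -[].
transitivity (\int[P]_w \int[mu]_y f (w, y))%E.
  apply: eq_integral => w _; under eq_integral do rewrite fE.
  rewrite ge0_integralZl//.
    by rewrite integral_indic// setIT.
  by apply/measurable_EFinP; exact: measurable_indic.
rewrite (fubini_tonelli (m1 := P) (m2 := mu) f mf f0).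
apply: eq_integral => y _.
pose G : set (Omega * d.-tuple R) := [set q | H ((q.1, y), q.2)].
have mG : measurable G.
  have mq : measurable_fun setT
      (fun q : Omega * d.-tuple R => ((q.1, y), q.2)).
    by apply: measurable_fun_pair => //; exact: measurable_fun_pair.
  by rewrite -[G]setTI; exact: (mq measurableT _ mH).
transitivity (\int[P]_w (mu \o xsection G) w)%E.
  by apply: eq_integral => w _; rewrite /= /f.
have := indic_fubini_tonelli P mu mG.
rewrite indic_fubini_tonelli_FE// indic_fubini_tonelli_GE// => ->.
apply: eq_integral => z _ /=.
rewrite (_ : ysection G _ = void_event Phi (cell_ball y `|` cell_ball z));
  last first.
  apply/seteqP; split => w; rewrite /ysection/void_event/= inE.
    by move=> [/typical_cell_void cy /typical_cell_void cz];
      rewrite setIUr cy cz setU0.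
  rewrite setIUr setU_eq0 => -[cy cz].
  by split; apply/typical_cell_void.
rewrite (void_probability lambda_gt0 PhiP)//.
- by apply: measurableU; exact: measurable_cell_ball.
- exact: lebesgue_cell_ballU_lty.
Qed.

Local Notation V := (cell_volume Phi).

Let measurable_cell_volume : measurable_fun setT V.
Proof.
exact: measurableT_comp (fine_measurable measurableT) measurable_volume.
Qed.

Let V_ge0 w : 0 <= V w.
Proof. by rewrite fine_ge0. Qed.

(** The volume is integrable, hence almost surely finite, so that taking its
    finite part does not change the mean. *)
Lemma expectation_cell_volume :
  ('E_P[V] = \int[mu]_y (expR (- cell_rate lambda y))%:E)%E.
Proof.
have int_volume : P.-integrable setT volume.
  apply/integrableP; split => //.
  under eq_integral do rewrite gee0_abs//.
  by rewrite mean_cell_volume integral_expR_cell_rate_lty.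
rewrite -mean_cell_volume unlock; apply: ge0_ae_eq_integral => //.
- exact/measurable_EFinP.
- by move=> w _; rewrite lee_fin.
have := integrable_ae measurableT int_volume.
apply: filterS => w /(_ I) vw _.
by rewrite /cell_volume fineK.
Qed.

Lemma expectation_sqr_cell_volume_le T : 0 <= T ->
  (\int[P]_w (V w ^+ 2)%:E <= 'E_P[V] * 'E_P[V] +
    ((T ^+ 3 * overlap_decay d + 256 * expR (- (T / 4))) / lambda ^+ 2)%:E)%E.
Proof.
move=> T0.
apply: (@le_trans _ _ (\int[P]_w (volume w * volume w))%E).
  apply: ge0_le_integral => //.
  - by move=> w _; rewrite lee_fin sqr_ge0.
  - by apply/measurable_EFinP; exact: measurable_funX.
  - exact: emeasurable_funM.
  move=> w _; rewrite /cell_volume -/(volume w).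
  have := volume_ge0 w; case: (volume w) => //= _.
  by rewrite mulyy leey.
rewrite second_moment_cell_volume.
apply: le_trans (integral_union_le lambda_gt0 d_gt0 T0) _.
rewrite -expectation_cell_volume -addeA -EFinD leeD2l// lee_fin.
rewrite le_eqVlt; apply/orP; left; apply/eqP; field.
by rewrite gt_eqF.
Qed.

(** The variance is at most D / lambda ^+ 2 and the mean at least
    expR (- 1) / lambda, so lambda cancels from the quotient. *)
Lemma rho_le T : 0 <= T ->
  (1 <= rho P Phi <=
    (1 + expR 2 * (T ^+ 3 * overlap_decay d + 256 * expR (- (T / 4))))%:E)%E.
Proof.
move=> T0; set D := T ^+ 3 * _ + _.
have := expectation_sqr_cell_volume_le T0; rewrite -/D.
have := integral_expR_cell_rate_ge lambda_gt0 d_gt0.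
have := integral_expR_cell_rate_lty lambda_gt0 d_gt0.
rewrite -expectation_cell_volume => Elty Ege.
have E0 : (0 <= 'E_P[V])%E by apply: expectation_ge0.
have : ('E_P[V] \is a fin_num)%E by rewrite ge0_fin_numE.
move=> /fineK Efin; move: Ege; rewrite -Efin; set E := fine _ => Ege.
have V2 : (\int[P]_w (V w ^+ 2)%:E < +oo)%E -> V \in Lfun P 2%:E.
  exact: Lfun2_of_sqr_lty.
rewrite -EFinM -EFinD => S_le; have Slty := le_lt_trans S_le (ltry _).
have vE := varianceE (V2 Slty).
move: vE.
have -> : ('E_P[(V ^+ 2)%R] = \int[P]_w (V w ^+ 2)%:E)%E by rewrite unlock.
have S0 : (0 <= \int[P]_w (V w ^+ 2)%:E)%E.
  by apply: integral_ge0 => w _; rewrite lee_fin sqr_ge0.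
have : (\int[P]_w (V w ^+ 2)%:E)%E \is a fin_num by rewrite ge0_fin_numE.
move=> /fineK Sfin; rewrite -Sfin in S_le *; set S := fine _ in S_le *.
rewrite -Efin -/E -EFin_expe -EFinB => vE.
have var0 := variance_ge0 P V.
rewrite /rho -Efin -/E vE -EFin_expe.
rewrite lee_fin in Ege S_le; rewrite vE lee_fin in var0.
have E_gt0 : 0 < E by apply: lt_le_trans Ege; rewrite divr_gt0// expR_gt0.
have D0 : 0 <= D.
  by rewrite !(addr_ge0, mulr_ge0) ?exprn_ge0 ?sqrtr_ge0 ?expR_ge0.
rewrite inver gt_eqF ?exprn_gt0// -EFinM -EFinD !lee_fin.
apply/andP; split; first by rewrite lerDl divr_ge0// sqr_ge0.
rewrite lerD2l ler_pdivrMr ?exprn_gt0//.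
apply: (@le_trans _ _ (D / lambda ^+ 2)); first by rewrite lerBlDl expr2.
rewrite ler_pdivrMr ?exprn_gt0//.
have : 1 <= expR 2 * (E ^+ 2 * lambda ^+ 2).
  rewrite -exprMn (_ : 2 = 2%:R * 1); last by rewrite mulr1.
  rewrite expRM_natl -exprMn exprn_ege1//.
  have : expR (- 1) <= E * lambda by rewrite -ler_pdivrMr.
  by rewrite expRN -[X in _ -> X <= _](divff (lt0r_neq0 (expR_gt0 1))) => ?;
    rewrite ler_pM2l ?expR_gt0.
nra.
Qed.

End moments.

(** * The limit *)

Lemma overlap_decay_cvg0 (R : realType) :
  overlap_decay d @[d --> \oo] --> (0 : R).
Proof.
rewrite -[X in _ --> X](addr0 (0 : R)); apply: cvgD; apply: cvg_expr.
  by rewrite ger0_norm; lra.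
by rewrite ger0_norm ?sqrtr_ge0// -[ltRHS](@sqrtr1 R) ltr_sqrt//; lra.
Qed.

Theorem corollary5 (R : realType) (lambda : R) (lambda_gt0 : 0 < lambda)
    (disp : nat -> measure_display)
    (Omega : forall d : nat, measurableType (disp d))
    (P : forall d : nat, probability (Omega d) R)
    (Phi : forall d : nat, Omega d -> set (d.-tuple R))
    (Phi_poisson : forall d : nat, (0 < d)%N ->
      homogeneous_poisson_process (P d) (Phi d) lambda) :
  rho (P d) (Phi d) @[d --> \oo] --> 1%E.
Proof.
have rhoP T d (T0 : 0 <= T) (d0 : (0 < d)%N) :=
  rho_le lambda_gt0 d0 (Phi_poisson d d0) T0.
have rho_fin d : (0 < d)%N -> rho (P d) (Phi d) \is a fin_num.
  move=> d0; have /andP[r1 r2] := rhoP 0 d (lexx _) d0.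
  by rewrite ge0_fin_numE ?(le_lt_trans r2 (ltry _))// (le_trans _ r1).
apply/fine_cvgP; split.
  by exists 1%N => // d /= d0; exact: rho_fin.
apply/cvgrPdist_le => e e0.
(* With T = 4 x the tail term is at most e / 2, because exp(- x) <= 1 / x. *)
pose x := 512 * expR 2 / e.
have x0 : 0 < x by rewrite divr_gt0// mulr_gt0// expR_gt0.
have T0 : 0 <= 4 * x by rewrite mulr_ge0// ltW.
have tail : expR 2 * (256 * expR (- (4 * x / 4))) <= e / 2.
  have -> : 4 * x / 4 = x by field.
  have : expR (- x) <= x^-1.
    rewrite expRN lef_pV2 ?posrE ?expR_gt0//.
    by apply: le_trans (expR_ge1Dx x); rewrite lerDr.
  have -> : x^-1 = e / 2 / (expR 2 * 256).
    by rewrite /x; field; rewrite !gt_eqF ?expR_gt0.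
  by rewrite ler_pdivlMr ?mulr_gt0 ?expR_gt0// mulrC mulrA.
have k0 : 0 < expR 2 * (4 * x) ^+ 3.
  by rewrite mulr_gt0 ?expR_gt0// exprn_gt0// mulr_gt0.
have d'0 : 0 < e / 2 / (expR 2 * (4 * x) ^+ 3) by rewrite divr_gt0// divr_gt0//.
have /cvgrPdist_le/(_ _ d'0) decay := @overlap_decay_cvg0 R.
near=> d.
have d0 : (0 < d)%N by near: d; exists 1%N.
have : overlap_decay d <= e / 2 / (expR 2 * (4 * x) ^+ 3).
  have : `|0 - overlap_decay d| <= e / 2 / (expR 2 * (4 * x) ^+ 3) by near: d.
  by rewrite sub0r normrN; apply: le_trans; exact: ler_norm.
rewrite ler_pdivlMr// => head.
have := rhoP (4 * x) d T0 d0; rewrite /= -(fineK (rho_fin d d0)) !lee_fin.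
move=> /andP[r1 r2]; rewrite distrC ger0_norm ?subr_ge0//=.
lra.
Unshelve. all: by end_near. Qed.
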